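(* There exists a universal constant $B>0$ such that the following holds. Let $n\ge 1$ and let $\sigma=(\sigma_1,\ldots,\sigma_n)$ be distributed according to the critical Curie--Weiss model, and let $W=S_n/n^{3/4}$, where $S_n=\sigma_1+\cdots+\sigma_n$ denotes the total spin. Then for every real $p\ge 3$ and all $z\in\mathbb{R}$, $$\left|\mathbb{P}(W\le z)-\mathbb{P}(Y\le z)\right|\le\frac{B^p\,p^{p/2}}{(1+|z|)^p\,n^{1/2}},$$ where $Y$ is a random variable with probability density function $p(x)=K\exp(-x^4/12)$, $x\in\mathbb{R}$, $K$ being the normalizing constant.
   Context: The critical Curie--Weiss model (inverse temperature $\beta=1$) on $n$ spins is the probability distribution on $\{-1,1\}^n$ given by $$\mathbb{P}(\sigma)=\frac{1}{Z}\exp\left(\frac{1}{n}\sum_{1\le i<j\le n}\sigma_i\sigma_j\right),\qquad \sigma=(\sigma_1,\ldots,\sigma_n)\in\{-1,1\}^n,$$ where $Z$ is the normalizing constant. A universal constant is one not depending on $n$, $p$, $z$. *)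

(* Defs.v *)
From HB Require Import structures.
From mathcomp Require Import all_boot all_order all_algebra.
From mathcomp Require Import all_classical all_reals all_analysis.
Set Implicit Arguments.
Unset Strict Implicit.
Unset Printing Implicit Defensive.
Import Order.TTheory GRing.Theory Num.Theory.
Import numFieldNormedType.Exports.
Local Open Scope classical_set_scope.
Local Open Scope ring_scope.

(* A point of {-1,1}^n is coded by s : {ffun 'I_n -> bool}, its i-th
   coordinate being spin (s i). *)
Definition spin (R : realType) (b : bool) : R := if b then 1 else -1.

Definition cw_weight (R : realType) (n : nat) (s : {ffun 'I_n -> bool}) : R :=
  expR (n%:R^-1 *
    \sum_(i < n) \sum_(j < n | (i < j)%N) spin R (s i) * spin R (s j)).

Definition cw_Z (R : realType) (n : nat) : R :=
  \sum_(s : {ffun 'I_n -> bool}) cw_weight R s.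

Definition cw_prob (R : realType) (n : nat) (s : {ffun 'I_n -> bool}) : R :=
  cw_weight R s / cw_Z R n.

(* The joint law of (sigma_1, ..., sigma_n) is prescribed on the atoms of
   {-1,1}^n. As cw_prob sums to 1, this determines the law: the vector lies in
   {-1,1}^n almost surely. *)
Definition critical_curie_weiss (d : measure_display) (T : measurableType d)
    (R : realType) (P : probability T R) (n : nat)
    (sigma : 'I_n -> {RV P >-> R}) : Prop :=
  forall s : {ffun 'I_n -> bool},
    P [set t | forall i, sigma i t = spin R (s i)] = (cw_prob R s)%:E.

Definition total_spin (d : measure_display) (T : measurableType d)
    (R : realType) (P : probability T R) (n : nat)
    (sigma : 'I_n -> {RV P >-> R}) (t : T) : R :=
  \sum_(i < n) sigma i t.

Definition has_density (d : measure_display) (T : measurableType d)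
    (R : realType) (P : probability T R) (Y : {RV P >-> R}) (f : R -> R) :
    Prop :=
  forall A : set R, measurable A ->
    distribution P Y A = (\int[lebesgue_measure]_(x in A) (f x)%:E)%E.

Definition quartic_K (R : realType) : R :=
  (\int[lebesgue_measure]_x expR (- x ^+ 4 / 12))^-1.

Definition quartic_density (R : realType) (x : R) : R :=
  quartic_K R * expR (- x ^+ 4 / 12).

(* Main.v *)
Require Import Defs.
From mathcomp Require Import all_boot all_order all_algebra.
From mathcomp Require Import all_classical all_reals all_analysis.
From mathcomp Require Import measurable_realfun.
From mathcomp Require Import ring lra zify.
Import Order.TTheory GRing.Theory Num.Theory.
Import numFieldNormedType.Exports.
Local Open Scope classical_set_scope.
Local Open Scope ring_scope.
Set Implicit Arguments.
Unset Strict Implicit.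
Unset Printing Implicit Defensive.

(** Write q for the fourth root of n. The total spin equals 2k - n with
probability proportional to C(n, k) exp((2k - n)^2 / (2n)). When the spin
passes from S to S + 2 this mass is multiplied by
  (1 - t) / (1 + t) * exp(2M / n),   where M = S + 1 and t = M / (n + 1).
As log((1 - t) / (1 + t)) = - 2t - 2t^3/3 - ..., the linear terms nearly
cancel at the critical temperature, and the cubic ones add up to
- S^4 / (12 n^3) = - x^4 / 12 at the lattice point x = S / q^3. Two-sided
control of the remainders gives the local limit theorem [cw_mass_local]: for a
scale A depending on n only, the mass at x >= 0 differs from A exp(- x^4 / 12)
by at most A C q^-2 x exp(- 2 x^2). No Stirling formula is needed, because A
is never computed.

With the lattice step h = 2 / q^3, the error h x exp(- 2 x^2) is dominated by
an increment of - exp(- x^2), so that the errors above a threshold z >= 0 add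
up to O(q^-2 exp(- z^2)); and the Riemann sum of K exp(- x^4 / 12) is within
O(h) exp(- z^4 / 12) of the tail P(Y > z) by monotonicity. Hence
[upper_mass_tail]: the mass of the spins above z, times K h / A, is within
C q^-2 exp(- z^2) of P(Y > z). At z = 0 both laws are symmetric, which shows
that K h / A differs from the inverse of the total mass by a relative error
O(q^-2); this removes the unknown normalisation [upper_prob_tail] and bounds
the difference of the distribution functions by C n^(-1/2) exp(- z^2), for
z < 0 again by symmetry. The moment form of the bound follows from
(1 + |z|)^p exp(- z^2) <= e p^(p/2) [powR_gauss_le]. *)

(** * Elementary inequalities *)

(** The remainder of log((1 - t) / (1 + t)) after - 2t - (2/3) t^3 - c t^5. *)
Definition log_ratio_gap {R : realType} (c t : R) : R :=
  ln (1 - t) - ln (1 + t) + 2 * t + 2 / 3 * t ^+ 3 + c * t ^+ 5.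

Lemma is_derive_log_ratio_gap {R : realType} (c t : R) : -1 < t < 1 ->
  is_derive t 1 (log_ratio_gap c) (t ^+ 4 * (5 * c - 2 / (1 - t ^+ 2))).
Proof.
move=> /andP[t1 t2].
have d1 : is_derive (1 - t) 1 (@ln R) (1 - t)^-1 by apply: is_derive1_ln; lra.
have d2 : is_derive (1 + t) 1 (@ln R) (1 + t)^-1 by apply: is_derive1_ln; lra.
have e1 : is_derive t 1 (fun t => ln (1 - t)) ((1 - t)^-1 * (0 - 1)).
  exact: is_derive1_comp.
have e2 : is_derive t 1 (fun t => ln (1 + t)) ((1 + t)^-1 * (0 + 1)).
  exact: is_derive1_comp.
rewrite /log_ratio_gap; apply: is_derive_eq.
have t12 : 1 - t ^+ 2 != 0.
  have -> : 1 - t ^+ 2 = (1 - t) * (1 + t) by ring.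
  by rewrite mulf_neq0// lt0r_neq0//; lra.
rewrite /GRing.scale /=; field.
by rewrite t12 /= !lt0r_neq0//; lra.
Qed.

(** The gap vanishes at 0; for c = 0 its derivative is nonpositive on [0, 1[,
and for c = 1 it is nonnegative on [0, 1/2]. *)
Lemma log_ratio_gap_MVT {R : realType} (c t : R) : 0 <= t < 1 ->
  exists2 s, 0 <= s <= t &
    log_ratio_gap c t = s ^+ 4 * (5 * c - 2 / (1 - s ^+ 2)) * t.
Proof.
move=> /andP[t0 t1].
have gd x : 0 <= x <= t -> is_derive x 1 (log_ratio_gap c)
    (x ^+ 4 * (5 * c - 2 / (1 - x ^+ 2))).
  by move=> /andP[x0 xt]; apply: is_derive_log_ratio_gap; lra.
have [||s] := @MVT_segment R (log_ratio_gap c)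
  (fun x => x ^+ 4 * (5 * c - 2 / (1 - x ^+ 2))) 0 t t0.
- by move=> x; rewrite in_itv /= => /andP[x0 xt]; apply: gd; rewrite !ltW.
- apply: derivable_within_continuous => x; rewrite in_itv /= => xt.
  by have [] := gd _ xt.
rewrite in_itv /= subr0 => st gap; exists s => //; rewrite -gap.
by rewrite /log_ratio_gap subr0 addr0 ln1 !expr0n/= !mulr0; ring.
Qed.

Lemma expR_log_ratio_gap {R : realType} (c t : R) : -1 < t < 1 ->
  (1 - t) / (1 + t) = expR (log_ratio_gap c t)
    * expR (- (2 * t + 2 / 3 * t ^+ 3 + c * t ^+ 5)).
Proof.
move=> /andP[t0 t1].
rewrite -expRD /log_ratio_gap; set u := ln _; set v := ln _.
have -> : u - v + 2 * t + 2 / 3 * t ^+ 3 + c * t ^+ 5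
  - (2 * t + 2 / 3 * t ^+ 3 + c * t ^+ 5) = u - v by ring.
by rewrite expRD expRN !lnK ?posrE//; lra.
Qed.

Lemma ratio_le_expR {R : realType} (t : R) : 0 <= t <= 1 ->
  (1 - t) / (1 + t) <= expR (- (2 * t + 2 / 3 * t ^+ 3)).
Proof.
move=> /andP[t0]; rewrite le_eqVlt => /predU1P[->|t1].
  by rewrite subrr mul0r expR_ge0.
rewrite (expR_log_ratio_gap 0) ?mul0r ?addr0; last lra.
rewrite ler_piMl ?expR_ge0// expR_le1.
have [|s /andP[s0 st] ->] := @log_ratio_gap_MVT R 0 t; first lra.
rewrite mulr0 sub0r mulrN mulNr oppr_le0 mulr_ge0// mulr_ge0 ?exprn_ge0//.
by rewrite divr_ge0// subr_ge0 expr_le1//; lra.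
Qed.

Lemma ratio_ge_expR {R : realType} (t : R) : 0 <= t <= 1 / 2 ->
  expR (- (2 * t + 2 / 3 * t ^+ 3 + t ^+ 5)) <= (1 - t) / (1 + t).
Proof.
move=> /andP[t0 t1].
rewrite (expR_log_ratio_gap 1) ?mul1r; last lra.
rewrite ler_peMl ?expR_ge0// -[leLHS]expR0 ler_expR.
have [|s /andP[s0 st] ->] := @log_ratio_gap_MVT R 1 t; first lra.
have s2 : s ^+ 2 <= 1 / 4 by rewrite expr2; nra.
rewrite mulr_ge0// mulr_ge0 ?exprn_ge0// subr_ge0 ler_pdivrMr; lra.
Qed.

Lemma mul_expRN_le1 {R : realType} (x : R) : x * expR (- x) <= 1.
Proof.
rewrite expRN ler_pdivrMr ?expR_gt0// mul1r.
by rewrite (le_trans _ (expR_ge1Dx x))// lerDr.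
Qed.

(** The difference of the exponents is (x^2 - 6k)^2 / 12. *)
Lemma expR_quartic_le {R : realType} (k x : R) :
  expR (- x ^+ 4 / 12) <= expR (3 * k ^+ 2) * expR (- (k * x ^+ 2)).
Proof.
rewrite -expRD ler_expR -subr_ge0.
have -> : 3 * k ^+ 2 + - (k * x ^+ 2) - - x ^+ 4 / 12 =
  (x ^+ 2 - 6 * k) ^+ 2 / 12 by field.
by rewrite divr_ge0 ?sqr_ge0.
Qed.

(** The left-hand side is the error of the local limit theorem as it comes out
of the bounds on the masses; the right-hand side is the form that can be
summed. The quartic exponential absorbs every Gaussian factor. *)
Lemma local_error_le {R : realType} (x : R) : 0 <= x ->
  x ^+ 2 * (4 + x ^+ 4) * expR (3 / 2 * x ^+ 2) * expR (- x ^+ 4 / 12) <=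
  4 * expR 91 * (x * expR (- (2 * x ^+ 2))).
Proof.
move=> x0; have y0 : 0 <= x ^+ 2 by rewrite sqr_ge0.
set y := x ^+ 2 in y0 *.
have y1 : x <= expR y.
  by rewrite (le_trans _ (expR_ge1Dx _))// /y expr2; nra.
have y2 : 4 + x ^+ 4 <= 4 * expR y.
  have h : 1 + y ^+ 2 / 2 <= expR y := @expR_ge1Dxn R y 1%N y0.
  have -> : x ^+ 4 = y ^+ 2 by rewrite /y -exprM.
  by have := sqr_ge0 y; move: h; set e := expR y; lra.
have y3 : expR (- x ^+ 4 / 12) <= expR (91 - 3 / 2 * y - 2 * y - 2 * y).
  rewrite ler_expR -subr_ge0.
  have -> : - x ^+ 4 / 12 = - y ^+ 2 / 12 by rewrite /y -exprM.
  have -> : 91 - 3 / 2 * y - 2 * y - 2 * y - - y ^+ 2 / 12 =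
    (y - 33) ^+ 2 / 12 + 1 / 4 by field.
  by rewrite addr_ge0// divr_ge0// sqr_ge0.
rewrite {1}(_ : y = x * x); last by rewrite /y expr2.
have -> : 4 * expR 91 * (x * expR (- (2 * y))) =
  x * expR y * (4 * expR y) * expR (3 / 2 * y)
   * expR (91 - 3 / 2 * y - 2 * y - 2 * y).
  have -> : 91 - 3 / 2 * y - 2 * y - 2 * y =
    91 + - (3 / 2 * y) + - y + - y + - (2 * y) by ring.
  by rewrite !expRD !expRN; field; rewrite !gt_eqF ?expR_gt0.
apply: ler_pM => //; rewrite ?expR_ge0//.
  by rewrite !mulr_ge0 ?expR_ge0 ?addr_ge0 ?exprn_ge0.
rewrite ler_wpM2r ?expR_ge0//; apply: ler_pM => //.
- by rewrite addr_ge0// exprn_ge0.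
- by rewrite ler_wpM2l.
Qed.

(** * The masses of the total spin and their local limit *)

(** The mass, before normalisation, of the configurations with k spins equal to
1, whose total spin is 2k - n. *)
Definition cw_mass (R : realType) (n k : nat) : R :=
  'C(n, k)%:R * expR ((2 * k%:R - n%:R) ^+ 2 / (2 * n%:R)).

(** The nonnegative values of the total spin, continued beyond n: for
uphalf n + j <= n, site n j is the total spin when uphalf n + j spins equal 1,
and site n 0 is 0 or 1 according to the parity of n. *)
Definition site (R : realType) (n j : nat) : R := (odd n + j.*2)%:R.

Lemma siteE {R : realType} (n j : nat) :
  site R n j = 2 * (uphalf n + j)%:R - n%:R.
Proof.
apply/eqP; rewrite eq_sym subr_eq -natrM -natrD; apply/eqP; congr (_%:R).
by have := odd_double_half n; rewrite uphalf_half; lia.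
Qed.

Lemma siteS {R : realType} (n j : nat) : site R n j.+1 = site R n j + 2.
Proof. by rewrite /site -natrD; congr (_%:R); lia. Qed.

Lemma site_ge0 {R : realType} (n j : nat) : 0 <= site R n j.
Proof. exact: ler0n. Qed.

Lemma site_leVge {R : realType} n j :
  site R n j <= n%:R \/ n%:R + 1 <= site R n j.
Proof.
rewrite /site natr1 !ler_nat.
by case: (leqP (odd n + j.*2) n) => h; [left|right].
Qed.

Lemma cw_mass_ge0 {R : realType} n k : 0 <= cw_mass R n k.
Proof. by rewrite mulr_ge0 ?expR_ge0. Qed.

Lemma cw_mass_gt0 {R : realType} n k : (k <= n)%N -> 0 < cw_mass R n k.
Proof. by move=> kn; rewrite mulr_gt0 ?expR_gt0// ltr0n bin_gt0. Qed.

Lemma cw_mass_eq0 {R : realType} n k : (n < k)%N -> cw_mass R n k = 0.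
Proof. by move=> nk; rewrite /cw_mass bin_small// mul0r. Qed.

Lemma cw_mass_site_eq0 {R : realType} n j : n%:R < site R n j ->
  cw_mass R n (uphalf n + j) = 0.
Proof.
rewrite /site ltr_nat => nj; apply: cw_mass_eq0.
by have := odd_double_half n; rewrite uphalf_half; lia.
Qed.

(** The ratio of consecutive masses, in terms of the midpoint M of the two
sites. *)
Lemma cw_massS {R : realType} n j : (0 < n)%N -> site R n j <= n%:R ->
  let M := site R n j + 1 in let t := M / (n%:R + 1) in
  cw_mass R n (uphalf n + j.+1) =
  cw_mass R n (uphalf n + j) * ((1 - t) / (1 + t) * expR (2 * M / n%:R)).
Proof.
move=> n0 Sn M t; set k := (uphalf n + j)%N.
have ME : M = 2 * k%:R - n%:R + 1 by rewrite /M siteE.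
have nR0 : 0 < n%:R :> R by rewrite ltr0n.
have kn : (k <= n)%N.
  by move: Sn; rewrite siteE -/k lerBlDr -natrM -natrD ler_nat; lia.
have kk : 0 <= k%:R :> R by [].
have bin : k.+1%:R * 'C(n, k.+1)%:R = (n%:R - k%:R) * 'C(n, k)%:R :> R.
  by rewrite -natrB// -!natrM mul_bin_left.
rewrite addnS -/k /cw_mass.
have -> : 'C(n, k.+1)%:R = (n%:R - k%:R) * 'C(n, k)%:R / (k%:R + 1) :> R.
  by rewrite -bin -natr1 mulrC mulKf// natr1 pnatr_eq0.
have -> : (1 - t) / (1 + t) = (n%:R - k%:R) / (k%:R + 1).
  rewrite /t ME; field; apply/and3P; split; apply: lt0r_neq0; lra.
have -> : (2 * k.+1%:R - n%:R) ^+ 2 / (2 * n%:R) =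
    (2 * k%:R - n%:R) ^+ 2 / (2 * n%:R) + 2 * M / n%:R.
  by rewrite ME -natr1; field; rewrite lt0r_neq0.
by rewrite expRD; ring.
Qed.

(** The scale A of the local limit theorem: the central mass divided by the
value of exp(- S^4 / (12 n^3)) at the smallest site, so that the profile is
exact there. *)
Definition cw_scale (R : realType) (n : nat) : R :=
  cw_mass R n (uphalf n) * expR (site R n 0 ^+ 4 / (12 * n%:R ^+ 3)).

Lemma cw_scale_gt0 {R : realType} n : 0 < cw_scale R n.
Proof. by rewrite mulr_gt0 ?expR_gt0 ?cw_mass_gt0// leq_uphalf_double; lia. Qed.

(** The ratio of the mass at a site S to A exp(- S^4 / (12 n^3)). *)
Definition cw_rho (R : realType) (n j : nat) : R :=
  cw_mass R n (uphalf n + j) * expR (site R n j ^+ 4 / (12 * n%:R ^+ 3))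
  / cw_scale R n.

Lemma cw_rho0 {R : realType} n : cw_rho R n 0 = 1.
Proof. by rewrite /cw_rho addn0 divff// lt0r_neq0// cw_scale_gt0. Qed.

Lemma cw_rho_ge0 {R : realType} n j : 0 <= cw_rho R n j.
Proof.
by rewrite divr_ge0 ?mulr_ge0 ?expR_ge0 ?cw_mass_ge0// ltW// cw_scale_gt0.
Qed.

Lemma cw_rhoS {R : realType} n j : (0 < n)%N -> site R n j <= n%:R ->
  let M := site R n j + 1 in let t := M / (n%:R + 1) in
  cw_rho R n j.+1 = cw_rho R n j * ((1 - t) / (1 + t)
    * expR (2 * (M / n%:R) + 2 / 3 * (M / n%:R) ^+ 3 + 2 / 3 * M / n%:R ^+ 3)).
Proof.
move=> n0 Sn M t; rewrite /cw_rho cw_massS// -/M -/t.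
have nR0 : 0 < n%:R :> R by rewrite ltr0n.
have -> : site R n j.+1 ^+ 4 / (12 * n%:R ^+ 3) =
    site R n j ^+ 4 / (12 * n%:R ^+ 3)
    + (2 / 3 * (M / n%:R) ^+ 3 + 2 / 3 * M / n%:R ^+ 3).
  by rewrite siteS /M; field; rewrite lt0r_neq0.
rewrite -[2 * (M / n%:R) + _ + _]addrA -[2 * M / n%:R]mulrA.
set u := site R n j ^+ 4 / _; set w := 2 / 3 * _ + _; set v := 2 * _.
by rewrite (expRD u) (expRD v); ring.
Qed.

(** The increment of log cw_rho is at most 6M / n^2, where 4M is the increment
of the square of the site; past n, cw_rho vanishes. *)
Lemma cw_rho_le {R : realType} n j : (0 < n)%N ->
  cw_rho R n j <= expR (3 / 2 * (site R n j / n%:R) ^+ 2).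
Proof.
move=> n0; have nR1 : 1 <= n%:R :> R by rewrite ler1n.
have nR0 : 0 < n%:R :> R by rewrite ltr0n.
elim: j => [|j IH].
  by rewrite cw_rho0 -[leLHS]expR0 ler_expR mulr_ge0 ?sqr_ge0.
case: (@site_leVge R n j) => [Sn|Sn]; last first.
  by rewrite /cw_rho cw_mass_site_eq0 ?mul0r ?expR_ge0// siteS; lra.
have S0 := @site_ge0 R n j.
rewrite cw_rhoS//; set M := site R n j + 1; set t := M / _.
have t01 : 0 <= t <= 1.
  by rewrite /t divr_ge0 ?ler_pdivrMr /M; lra.
set E := expR _.
apply: (@le_trans _ _ (expR (3 / 2 * (site R n j / n%:R) ^+ 2) *
    (expR (- (2 * t + 2 / 3 * t ^+ 3)) * E))).
  apply: ler_pM => //; first exact: cw_rho_ge0.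
    by rewrite mulr_ge0 ?expR_ge0// divr_ge0; lra.
  by rewrite ler_wpM2r ?expR_ge0// ratio_le_expR.
rewrite /E {E}.
rewrite -!expRD ler_expR siteS.
have -> : site R n j + 2 = M + 1 by rewrite /M; ring.
have -> : site R n j = M - 1 by rewrite /M; ring.
have tE : t = M * (n%:R + 1)^-1 by [].
set b := (n%:R + 1)^-1 in tE; set a := n%:R^-1.
have a0 : 0 < a by rewrite invr_gt0.
have b0 : 0 < b by rewrite invr_gt0; lra.
have a1 : a <= 1 by rewrite invf_le1.
have ab : a - b = a * b by rewrite /a /b; field; rewrite !lt0r_neq0//; lra.
have M0 : 0 <= M by rewrite /M; lra.
have Mb : M * b <= 1 by case/andP: t01; rewrite tE.
have Ma : M * a <= 2 by rewrite ler_pdivrMr /M//; lra.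
have -> : n%:R ^- 3 = a ^+ 3 by rewrite exprVn.
rewrite tE.
have ba : b <= a by rewrite -subr_ge0 ab ltW// mulr_gt0.
(* With a = 1 / n and b = 1 / (n + 1), the linear, cubic and last terms are at
   most 2, 8/3 and 2/3 times M a^2. *)
have e1 : M * a - M * b <= M * a ^+ 2.
  by rewrite -mulrBr ab ler_wpM2l// expr2 ler_wpM2l// ltW.
have e2 : (M * a) ^+ 3 - (M * b) ^+ 3 <= 4 * (M * a ^+ 2).
  have -> : (M * a) ^+ 3 - (M * b) ^+ 3 =
     M * a * ((M * b) * (M * a) * a + (M * b) * (M * b) * a
       + (M * b) * (M * b) * b).
    have -> : (M * a) ^+ 3 - (M * b) ^+ 3 =
      M ^+ 3 * (a - b) * (a ^+ 2 + a * b + b ^+ 2) by ring.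
    by rewrite ab; ring.
  have -> : 4 * (M * a ^+ 2) =
    M * a * (1 * 2 * a + 1 * 1 * a + 1 * 1 * a) by ring.
  have Ma0 : 0 <= M * a by rewrite mulr_ge0// ltW.
  have Mb0 : 0 <= M * b by rewrite mulr_ge0// ltW.
  have aa : 0 <= a by exact: ltW.
  have bb : 0 <= b by exact: ltW.
  rewrite ler_wpM2l// lerD// ?lerD//; apply: ler_pM => //;
    rewrite ?mulr_ge0//; apply: ler_pM => //.
have e3 : M * a ^+ 3 <= M * a ^+ 2.
  by rewrite ler_wpM2l// exprS ler_piMl// sqr_ge0.
have -> : 3 / 2 * ((M + 1) * a) ^+ 2 =
    3 / 2 * ((M - 1) * a) ^+ 2 + 6 * (M * a ^+ 2).
  by move: (M) (a) => m c; field.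
have e4 : 0 <= M * a ^+ 2 by rewrite mulr_ge0 ?sqr_ge0.
move: e1 e2 e3 e4; set u1 := M * a ^+ 2; set u2 := M * a; set u3 := M * b.
rewrite -[2 / 3 * M * a ^+ 3]mulrA; set u4 := M * a ^+ 3.
by set v := _ ^+ 2; lra.
Qed.

(** Below n / 2 the increment of log cw_rho is at least - (M / n)^5, and 12 M^5
is at most the increment of the sixth power of the site. *)
Lemma cw_rho_ge {R : realType} n j : (0 < n)%N -> site R n j <= n%:R / 2 ->
  expR (- ((site R n j / n%:R) ^+ 6 * n%:R / 12)) <= cw_rho R n j.
Proof.
move=> n0; have nR1 : 1 <= n%:R :> R by rewrite ler1n.
have nR0 : 0 < n%:R :> R by rewrite ltr0n.
elim: j => [|j IH].
  move=> _; rewrite cw_rho0 -[leRHS]expR0 ler_expR oppr_le0.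
  by rewrite divr_ge0// mulr_ge0// exprn_ge0// divr_ge0// site_ge0.
rewrite siteS => S2.
have S0 := @site_ge0 R n j.
have Sn : site R n j <= n%:R by lra.
have {}IH := IH ltac:(lra).
rewrite cw_rhoS//; set M := site R n j + 1; set t := M / _.
have t01 : 0 <= t <= 1 / 2.
  by rewrite /t divr_ge0 ?ler_pdivrMr /M; lra.
set E := expR (2 * _ + _ + _).
apply: (@le_trans _ _ (expR (- ((site R n j / n%:R) ^+ 6 * n%:R / 12)) *
    (expR (- (2 * t + 2 / 3 * t ^+ 3 + t ^+ 5)) * E))); last first.
  apply: ler_pM => //; rewrite ?mulr_ge0 ?expR_ge0//.
  by rewrite ler_wpM2r ?expR_ge0// ratio_ge_expR.
rewrite /E {E} -!expRD ler_expR.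
have -> : site R n j + 2 = M + 1 by rewrite /M; ring.
have -> : site R n j = M - 1 by rewrite /M; ring.
have tE : t = M * (n%:R + 1)^-1 by [].
have na : (n%:R : R) * n%:R^-1 = 1 by rewrite divff// lt0r_neq0.
rewrite tE; set b := (n%:R + 1)^-1; rewrite -[n%:R ^- 3]exprVn.
move: na; set a := n%:R^-1 => na.
have b0 : 0 < b by rewrite invr_gt0; lra.
have a0 : 0 < a by rewrite invr_gt0.
have ba : b <= a by rewrite lef_pV2 ?posrE; lra.
have M0 : 0 <= M by rewrite /M; lra.
have Mb0 : 0 <= M * b by rewrite mulr_ge0// ltW.
have Mba : M * b <= M * a by rewrite ler_wpM2l.
have e3 : (M * b) ^+ 3 <= (M * a) ^+ 3 by rewrite lerXn2r ?nnegrE//; lra.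
have e5 : (M * b) ^+ 5 <= (M * a) ^+ 5 by rewrite lerXn2r ?nnegrE//; lra.
have -> : (((M + 1) * a) ^+ 6 * n%:R / 12) = (((M - 1) * a) ^+ 6 * n%:R / 12) +
   (M ^+ 5 + 10 / 3 * M ^+ 3 + M) * a ^+ 5 * (n%:R * a) by field.
rewrite na mulr1.
have -> : (M ^+ 5 + 10 / 3 * M ^+ 3 + M) * a ^+ 5 =
  (M * a) ^+ 5 + (10 / 3 * M ^+ 3 + M) * a ^+ 5 by ring.
have : 0 <= (10 / 3 * M ^+ 3 + M) * a ^+ 5.
  by rewrite mulr_ge0 ?addr_ge0 ?mulr_ge0 ?exprn_ge0// ltW.
have : 0 <= 2 / 3 * M * a ^+ 3 by rewrite !mulr_ge0 ?exprn_ge0// ltW.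
move: e3 e5 Mba; set v3 := (M * b) ^+ 3; set v5 := (M * b) ^+ 5.
set u3 := (M * a) ^+ 3; set u5 := (M * a) ^+ 5.
set v := M * b; set u := M * a.
set w1 := 2 / 3 * M * _; set w2 := (_ + M) * _.
set w := (_ ^+ 6) * _ / _.
lra.
Qed.

(** The sites rescaled to values of the normalised spin; q stands for the
fourth root of n. *)
Definition lattice {R : realType} (q : R) (n j : nat) : R :=
  site R n j / q ^+ 3.

(** The local limit theorem. It is valid at every index j: beyond n the mass
vanishes and the right-hand side dominates the quartic profile. *)
Lemma cw_mass_local {R : realType} n (q : R) j :
  (0 < n)%N -> 0 < q -> q ^+ 4 = n%:R ->
  `|cw_mass R n (uphalf n + j)
    - cw_scale R n * expR (- lattice q n j ^+ 4 / 12)| <=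
  cw_scale R n * (4 * expR 91 / q ^+ 2
    * (lattice q n j * expR (- (2 * lattice q n j ^+ 2)))).
Proof.
move=> n0 q0 qn; set x := lattice q n j.
have nR0 : 0 < n%:R :> R by rewrite ltr0n.
have A0 := @cw_scale_gt0 R n.
have qN : q != 0 by rewrite lt0r_neq0.
have x0 : 0 <= x by rewrite divr_ge0 ?site_ge0// exprn_ge0// ltW.
set r := cw_rho R n j; set e := expR (- x ^+ 4 / 12).
have mE : cw_mass R n (uphalf n + j) = cw_scale R n * (r * e).
  rewrite /r /cw_rho /e -qn.
  have -> : - x ^+ 4 / 12 = - (site R n j ^+ 4 / (12 * (q ^+ 4) ^+ 3)).
    by rewrite /x /lattice; field.
  rewrite expRN; field.
  by rewrite !lt0r_neq0// expR_gt0.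
rewrite mE -[X in _ - _ * X]mul1r -mulrBr -mulrBl normrM (gtr0_norm A0).
rewrite ler_pM2l// normrM (ger0_norm (expR_ge0 _)).
have r0 : 0 <= r := cw_rho_ge0 n j.
have SE : (site R n j / n%:R) ^+ 2 = x ^+ 2 / q ^+ 2.
  by rewrite -qn /x /lattice; field.
have xq : 0 <= x ^+ 2 / q ^+ 2 by rewrite divr_ge0 ?sqr_ge0.
have q1 : 1 <= q ^+ 2.
  have : 1 <= (q ^+ 2) ^+ 2 by rewrite -exprM qn ler1n.
  by rewrite expr_ge1// sqr_ge0.
have xqx : x ^+ 2 / q ^+ 2 <= x ^+ 2.
  by rewrite ler_pdivrMr ?exprn_gt0// ler_peMr// sqr_ge0.
suff rB : `|r - 1| <= x ^+ 2 * (4 + x ^+ 4) * expR (3 / 2 * x ^+ 2) / q ^+ 2.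
  apply: le_trans (ler_wpM2r (expR_ge0 _) rB) _.
  rewrite mulrAC [leRHS]mulrAC ler_wpM2r ?invr_ge0 ?sqr_ge0//.
  exact: local_error_le.
have E1 : 1 <= expR (3 / 2 * x ^+ 2).
  by rewrite -[leLHS]expR0 ler_expR mulr_ge0 ?sqr_ge0.
have x40 : 0 <= x ^+ 4 by rewrite exprn_ge0.
(* From e^v - 1 <= v e^v. *)
have upper : r - 1 <= 3 / 2 * (x ^+ 2 / q ^+ 2) * expR (3 / 2 * x ^+ 2).
  have := @cw_rho_le R n j n0; rewrite -/r SE.
  set v := 3 / 2 * (x ^+ 2 / q ^+ 2) => rv.
  have v0 : 0 <= v by rewrite mulr_ge0.
  have h1 : expR v - 1 <= v * expR v.
    have := expR_ge1Dx (- v); rewrite expRN => h.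
    have := ler_wpM2r (expR_ge0 v) h; rewrite mulVf ?gt_eqF ?expR_gt0//; lra.
  have h2 : v * expR v <= v * expR (3 / 2 * x ^+ 2).
    by rewrite ler_wpM2l// ler_expR ler_wpM2l.
  lra.
have lower : 1 - r <= (4 + x ^+ 4) * (x ^+ 2 / q ^+ 2).
  have [Sn|Sn] := leP (site R n j) (n%:R / 2).
    have := @cw_rho_ge R n j n0 Sn; rewrite -/r.
    have -> : (site R n j / n%:R) ^+ 6 * n%:R / 12 =
        x ^+ 4 * (x ^+ 2 / q ^+ 2) / 12.
      by rewrite -qn /x /lattice; field.
    set v := x ^+ 4 * (x ^+ 2 / q ^+ 2) => rv.
    have v0 : 0 <= v by rewrite mulr_ge0.
    have := expR_ge1Dx (- (v / 12)).
    rewrite mulrDl -/v; lra.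
    (* For S > n / 2 no lower bound on r is needed: x^2 / q^2 = (S / n)^2 is not
       small. *)
  have : 1 / 4 <= x ^+ 2 / q ^+ 2.
    rewrite -SE -[1 / 4](_ : (1 / 2) ^+ 2 = _); last by field.
    by rewrite lerXn2r ?nnegrE ?divr_ge0 ?site_ge0// ler_pdivlMr//; lra.
  have : 0 <= x ^+ 4 * (x ^+ 2 / q ^+ 2) by rewrite mulr_ge0.
  rewrite mulrDl; lra.
have -> : x ^+ 2 * (4 + x ^+ 4) * expR (3 / 2 * x ^+ 2) / q ^+ 2 =
   (4 + x ^+ 4) * (x ^+ 2 / q ^+ 2) * expR (3 / 2 * x ^+ 2) by ring.
rewrite ler_norml; apply/andP; split.
  rewrite lerNl opprB; apply: le_trans lower _.
  by rewrite ler_peMr// mulr_ge0// addr_ge0.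
apply: le_trans upper _; rewrite ler_wpM2r ?expR_ge0// ler_wpM2r//.
lra.
Qed.

(** * Sums over the lattice and quartic tails *)

(** One step of the telescoping bound for the sum of the local errors. *)
Lemma gauss_step_le {R : realType} (x h : R) : 0 <= x -> 0 <= h <= 2 ->
  h * (x * expR (- (2 * x ^+ 2))) <=
  7 / 2 * (expR (- x ^+ 2) - expR (- (x + h) ^+ 2)).
Proof.
move=> x0 /andP[h0 h2].
set d := 2 * h * x + h ^+ 2.
have hx : 0 <= h * x by rewrite mulr_ge0.
have d0 : 0 <= d by rewrite /d -mulrA addr_ge0 ?mulr_ge0 ?sqr_ge0.
have -> : - (x + h) ^+ 2 = - x ^+ 2 + - d by rewrite /d; ring.
rewrite expRD -[X in X - _]mulr1 -mulrBr.
have -> : - (2 * x ^+ 2) = - x ^+ 2 + - x ^+ 2 by ring.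
rewrite expRD mulrA mulrA [X in _ <= X]mulrCA mulrC ler_pM2l ?expR_gt0//.
have ed : expR (- d) <= (1 + d)^-1.
  by rewrite expRN lef_pV2 ?posrE ?expR_gt0 ?expR_ge1Dx//; lra.
have dE : d / (1 + d) <= 1 - expR (- d).
  have -> : d / (1 + d) = 1 - (1 + d)^-1 by field; rewrite lt0r_neq0//; lra.
  lra.
have ex : expR (- x ^+ 2) * (1 + d) <= 7.
  have h4 : h ^+ 2 <= 4 by rewrite expr2; nra.
  have x2 : 2 * x <= 1 + x ^+ 2.
    rewrite -subr_ge0 (_ : _ - _ = (x - 1) ^+ 2) ?sqr_ge0//; ring.
  have hx2 : h * x <= 2 * x by rewrite ler_wpM2r.
  have y := expR_ge1Dx (x ^+ 2).
  rewrite expRN mulrC ler_pdivrMr ?expR_gt0//.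
  have := sqr_ge0 x; rewrite /d -mulrA; lra.
apply: (@le_trans _ _ (7 / 2 * (d / (1 + d)))); last by rewrite ler_wpM2l.
rewrite mulrA ler_pdivlMr; last lra.
have hd : 2 * (h * x) <= d by rewrite /d -mulrA lerDl sqr_ge0.
rewrite -(mulrA (h * x)) (le_trans (ler_wpM2l hx ex))//; lra.
Qed.

Lemma gauss_sum_le {R : realType} (x h : R) m : 0 <= x -> 0 <= h <= 2 ->
  \sum_(i < m) h * ((x + h * i%:R) * expR (- (2 * (x + h * i%:R) ^+ 2))) <=
  7 / 2 * expR (- x ^+ 2).
Proof.
move=> x0 h02; have h0 : 0 <= h by case/andP: h02.
suff H : \sum_(i < m) h * ((x + h * i%:R) * expR (- (2 * (x + h * i%:R) ^+ 2)))
    <= 7 / 2 * (expR (- x ^+ 2) - expR (- (x + h * m%:R) ^+ 2)).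
  by apply: le_trans H _; rewrite ler_wpM2l// gerBl expR_ge0.
elim: m => [|m IH]; first by rewrite big_ord0 mulr0 addr0 subrr mulr0.
rewrite big_ord_recr /=.
have y0 : 0 <= x + h * m%:R by rewrite addr_ge0 ?mulr_ge0.
apply: le_trans (lerD IH (gauss_step_le y0 h02)) _.
have -> : x + h * m.+1%:R = x + h * m%:R + h by rewrite -natr1; ring.
by rewrite -mulrDr addrA subrK.
Qed.

(** T behaves like the upper tail a |-> P(Y > a) on a >= 0 of a symmetric law
with density K exp(- x^4 / 12); D is the constant of a Gaussian bound on it.
Only the nonnegativity of T is required at negative arguments. *)
Record quartic_tail {R : realType} (K D : R) (T : R -> R) : Prop := {
  tail_K_ge0 : 0 <= K;
  tail_lower : forall a b, 0 <= a -> a <= b ->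
    K * (b - a) * expR (- b ^+ 4 / 12) <= T a - T b;
  tail_upper : forall a b, 0 <= a -> a <= b ->
    T a - T b <= K * (b - a) * expR (- a ^+ 4 / 12);
  tail_ge0 : forall a, 0 <= T a;
  tail_gauss : forall a, 0 <= a -> T a <= D * expR (- (2 * a ^+ 2));
  tail_half : T 0 = 1 / 2 }.

(** Riemann sums of K exp(- x^4 / 12) against tails: the first point x of the
sum need only be within one step of the threshold z. *)
Lemma quartic_riemann {R : realType} (K D : R) T (z x h : R) m :
  quartic_tail K D T -> 0 <= z -> z <= x -> x <= z + h ->
  `|\sum_(i < m) K * h * expR (- (x + h * i%:R) ^+ 4 / 12) - T z| <=
  K * h * expR (- z ^+ 4 / 12) + T (x + h * m%:R).
Proof.
move=> qT z0 zx xzh.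
have K0 := tail_K_ge0 qT; have h0 : 0 <= h by lra.
have x0 : 0 <= x by lra.
set e := fun i : nat => expR (- (x + h * i%:R) ^+ 4 / 12).
have y0 (i : nat) : 0 <= x + h * i%:R by rewrite addr_ge0 ?mulr_ge0.
have ysub (i : nat) : x + h * i.+1%:R - (x + h * i%:R) = h.
  by rewrite -natr1; ring.
have yle (i : nat) : x + h * i%:R <= x + h * i.+1%:R by rewrite -subr_ge0 ysub.
(* By monotonicity, K h e_(i+1) <= T(y_i) - T(y_(i+1)) <= K h e_i at the points
   y_i of the sum. *)
have lower : T x - T (x + h * m%:R) <= \sum_(i < m) K * h * e i.
  elim: m => [|m IH]; first by rewrite big_ord0 mulr0 addr0 subrr.
  rewrite big_ord_recr /=.
  by have := tail_upper qT (y0 m) (yle m); rewrite ysub -/(e m); lra.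
have upper : \sum_(i < m) K * h * e i <= K * h * e 0%N + T x - T (x + h * m%:R).
  suff : \sum_(i < m) K * h * e i <=
      K * h * e 0%N - K * h * e m + T x - T (x + h * m%:R).
    have : 0 <= K * h * e m by rewrite !mulr_ge0// expR_ge0.
    lra.
  elim: m {lower} => [|m IH].
    by rewrite big_ord0 mulr0 addr0 subrr add0r subrr.
  rewrite big_ord_recr /=.
  by have := tail_lower qT (y0 m) (yle m); rewrite ysub -/(e m.+1); lra.
have zxT : T z - T x <= K * h * expR (- z ^+ 4 / 12).
  apply: le_trans (tail_upper qT z0 zx) _.
  by rewrite ler_wpM2r ?expR_ge0// ler_wpM2l//; lra.
have zxT0 : 0 <= T z - T x.
  apply: le_trans (tail_lower qT z0 zx).
  by rewrite !mulr_ge0 ?expR_ge0 ?subr_ge0.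
have e0 : K * h * e 0%N <= K * h * expR (- z ^+ 4 / 12).
  rewrite ler_wpM2l ?mulr_ge0// ler_expR mulr0 addr0 ler_pM2r//.
  by rewrite lerN2 lerXn2r ?nnegrE.
have := tail_ge0 qT (x + h * m%:R).
rewrite ler_norml; move: lower upper zxT zxT0 e0.
rewrite -/(\sum_(i < m) K * h * e i).
set s := \sum_(i < m) _ => *; apply/andP; split; lra.
Qed.

(** The mass of the total spins which are at least site n j. The sum has n
terms, which suffices for n > 0; those beyond the largest spin are zero. *)
Definition upper_mass (R : realType) (n j : nat) : R :=
  \sum_(i < n) cw_mass R n (uphalf n + (j + i)).

Lemma latticeD {R : realType} (q : R) n j i :
  lattice q n (j + i) = lattice q n j + 2 / q ^+ 3 * i%:R.
Proof.
rewrite /lattice /site doubleD addnA natrD mulrDl; congr (_ + _).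
by rewrite -muln2 natrM; ring.
Qed.

(** The constant of upper_mass_tail: the three terms bound the local errors,
the Riemann sum and the tail beyond the last lattice point. *)
Definition cmp_const {R : realType} (K D : R) : R :=
  14 * K * expR 91 + 2 * K * expR 12 + D.

Lemma quartic_tail_D_ge0 {R : realType} (K D : R) T :
  quartic_tail K D T -> 0 <= D.
Proof.
move=> qT; have := le_trans (tail_ge0 qT 0) (tail_gauss qT (lexx 0)).
by rewrite expr0n/= mulr0 oppr0 expR0 mulr1.
Qed.

(** The upper masses follow the quartic tail, up to a factor which depends on n
only and is not yet known to be close to the inverse of the total mass. *)
Lemma upper_mass_tail {R : realType} (K D : R) T n (q z : R) j :
  quartic_tail K D T -> (0 < n)%N -> 0 < q -> q ^+ 4 = n%:R ->
  0 <= z -> z <= lattice q n j -> lattice q n j <= z + 2 / q ^+ 3 ->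
  `|K * (2 / q ^+ 3) / cw_scale R n * upper_mass R n j - T z| <=
  cmp_const K D / q ^+ 2 * expR (- z ^+ 2).
Proof.
move=> qT n0 q0 qn z0 zx xz; have K0 := tail_K_ge0 qT.
have D0 := quartic_tail_D_ge0 qT.
have A0 := @cw_scale_gt0 R n.
have q1 : 1 <= q.
  have : 1 <= q ^+ 4 by rewrite qn ler1n.
  by rewrite expr_ge1// ltW.
set h := 2 / q ^+ 3.
have h02 : 0 <= h <= 2.
  have q30 : 0 < q ^+ 3 by rewrite exprn_gt0.
  apply/andP; split; first by rewrite /h divr_ge0// ltW.
  by rewrite /h ler_pdivrMr// ler_peMr// exprn_ege1.
have /andP[h0 _] := h02.
have hq2 : h <= 2 / q ^+ 2.
  rewrite /h ler_wpM2l// lef_pV2 ?posrE ?exprn_gt0//.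
  by rewrite [leRHS]exprS ler_peMl// exprn_ge0// ltW.
set x := lattice q n j in zx xz *.
have x0 : 0 <= x := le_trans z0 zx.
set S := \sum_(i < n) K * h * expR (- (x + h * i%:R) ^+ 4 / 12).
have ez : expR (- x ^+ 2) <= expR (- z ^+ 2).
  by rewrite ler_expR lerN2 lerXn2r ?nnegrE.
have ez1 : expR (- (2 * z ^+ 2)) <= expR (- z ^+ 2).
  by rewrite ler_expR lerN2; have := sqr_ge0 z; lra.
have q20 : 0 < q ^+ 2 by rewrite exprn_gt0.
have d1 : `|K * h / cw_scale R n * upper_mass R n j - S| <=
    14 * K * expR 91 / q ^+ 2 * expR (- z ^+ 2).
  rewrite mulr_sumr -sumrB.
  apply: le_trans (ler_norm_sum _ _ _) _.
  apply: (@le_trans _ _ (K * (4 * expR 91 / q ^+ 2) * \sum_(i < n)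
    h * ((x + h * i%:R) * expR (- (2 * (x + h * i%:R) ^+ 2))))).
    rewrite mulr_sumr; apply: ler_sum => i _.
    have := @cw_mass_local R n q (j + i) n0 q0 qn.
    rewrite latticeD -/x -/h => loc.
    have -> : K * h / cw_scale R n * cw_mass R n (uphalf n + (j + i)) -
        K * h * expR (- (x + h * i%:R) ^+ 4 / 12) =
        K * h / cw_scale R n * (cw_mass R n (uphalf n + (j + i)) -
          cw_scale R n * expR (- (x + h * i%:R) ^+ 4 / 12)).
      by field; rewrite lt0r_neq0.
    have kh : 0 <= K * h / cw_scale R n := divr_ge0 (mulr_ge0 K0 h0) (ltW A0).
    rewrite normrM (ger0_norm kh).
    apply: le_trans (ler_wpM2l kh loc) _.
    rewrite le_eqVlt; apply/orP; left; apply/eqP; field.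
    by rewrite !lt0r_neq0.
  have c0 : 0 <= K * (4 * expR 91 / q ^+ 2).
    by rewrite mulr_ge0// divr_ge0 ?mulr_ge0 ?expR_ge0// ltW.
  apply: le_trans (ler_wpM2l c0 (gauss_sum_le n x0 h02)) _.
  have -> : 14 * K * expR 91 / q ^+ 2 * expR (- z ^+ 2) =
    K * (4 * expR 91 / q ^+ 2) * (7 / 2 * expR (- z ^+ 2)).
    by field; rewrite lt0r_neq0.
  by rewrite ler_wpM2l// ler_wpM2l.
have d2 := @quartic_riemann R K D T z x h n qT z0 zx xz.
have d3 : K * h * expR (- z ^+ 4 / 12) <=
    2 * K * expR 12 / q ^+ 2 * expR (- z ^+ 2).
  have -> : 2 * K * expR 12 / q ^+ 2 * expR (- z ^+ 2) =
    K * (2 / q ^+ 2) * (expR 12 * expR (- z ^+ 2)) by field; rewrite lt0r_neq0.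
  apply: ler_pM; [exact: mulr_ge0|exact: expR_ge0|exact: ler_wpM2l|].
  have := expR_quartic_le 2 z; rewrite (_ : 3 * 2 ^+ 2 = 12); last by ring.
  by move=> h12; rewrite (le_trans h12)// ler_wpM2l ?expR_ge0.
have d4 : T (x + h * n%:R) <= D / q ^+ 2 * expR (- z ^+ 2).
  set y := x + h * n%:R.
    (* The n steps of the sum lead beyond q, where the tail is O(q^-2). *)
  have hn : h * n%:R = 2 * q by rewrite /h -qn; field; rewrite lt0r_neq0.
  have yq : q <= y by rewrite /y hn; lra.
  have y0 : 0 <= y by lra.
  apply: le_trans (tail_gauss qT y0) _.
  rewrite -mulrA ler_wpM2l//.
  have -> : - (2 * y ^+ 2) = - y ^+ 2 + - y ^+ 2 by ring.
  rewrite expRD; apply: ler_pM; rewrite ?expR_ge0//.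
    have y20 : 0 < y ^+ 2 by rewrite exprn_gt0//; lra.
    apply: (@le_trans _ _ (y ^+ 2)^-1).
      by rewrite -div1r ler_pdivlMr// mulrC mul_expRN_le1.
    by rewrite lef_pV2 ?posrE// lerXn2r ?nnegrE// ltW.
  by rewrite ler_expR lerN2 lerXn2r ?nnegrE// /y hn; lra.
have -> : cmp_const K D / q ^+ 2 * expR (- z ^+ 2) =
   14 * K * expR 91 / q ^+ 2 * expR (- z ^+ 2) +
   (2 * K * expR 12 / q ^+ 2 * expR (- z ^+ 2) + D / q ^+ 2 * expR (- z ^+ 2)).
  by rewrite /cmp_const; ring.
apply: le_trans (lerD d1 (le_trans d2 (lerD d3 d4))).
exact: ler_distD.
Qed.

Definition cw_total (R : realType) (n : nat) : R :=
  \sum_(k < n.+1) cw_mass R n k.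

Lemma cw_total_gt0 (R : realType) n : 0 < cw_total R n.
Proof.
rewrite /cw_total big_ord_recl ltr_wpDr ?cw_mass_gt0//.
by apply: sumr_ge0 => i _; exact: cw_mass_ge0.
Qed.

Lemma cw_mass_sym (R : realType) n k : (k <= n)%N ->
  cw_mass R n (n - k) = cw_mass R n k.
Proof.
move=> kn; rewrite /cw_mass bin_sub// natrB//.
have -> // : 2 * (n%:R - k%:R) - n%:R = - (2 * k%:R - n%:R) :> R by ring.
by rewrite sqrrN.
Qed.

Lemma upper_massE (R : realType) n j : (0 < n)%N ->
  upper_mass R n j = \sum_(k < n.+1 | (uphalf n + j <= k)%N) cw_mass R n k.
Proof.
move=> n0; rewrite /upper_mass.
rewrite -(big_mkord (fun k => (uphalf n + j <= k)%N) (cw_mass R n)).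
rewrite -(big_mkord xpredT (fun i => cw_mass R n (uphalf n + (j + i)))).
set a := (uphalf n + j)%N.
have -> : \sum_(0 <= i < n) cw_mass R n (uphalf n + (j + i)) =
  \sum_(a <= k < a + n) cw_mass R n k.
  rewrite -{1}[a]add0n [RHS]big_addn addKn; apply: eq_bigr => i _.
  by congr (cw_mass _ _ _); rewrite /a; lia.
have an : (n < a + n)%N by rewrite /a uphalf_half; lia.
have -> : \sum_(0 <= k < n.+1 | (a <= k)%N) cw_mass R n k =
    \sum_(a <= k < n.+1) cw_mass R n k.
  by rewrite [RHS](@big_nat_widenl _ _ _ _ 0).
have vanish m1 m2 : (n < m1)%N -> \sum_(m1 <= k < m2) cw_mass R n k = 0.
  move=> nm; rewrite big_nat big1// => k /andP[mk _].
  by rewrite cw_mass_eq0//; exact: leq_trans mk.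
have [a1|a1] := leqP a n.+1; last by rewrite !vanish// ltnW.
by rewrite (@big_cat_nat _ _ _ n.+1)//= (vanish n.+1)// addr0.
Qed.

(** By symmetry, spins >= 0 and spins > 0 have together the total mass. *)
Lemma upper_mass_total (R : realType) n : (0 < n)%N ->
  upper_mass R n 0 + upper_mass R n (~~ odd n) = cw_total R n.
Proof.
move=> n0; rewrite !upper_massE// addn0 /cw_total.
rewrite [RHS](bigID (fun k : 'I_n.+1 => (uphalf n <= k)%N)) /=; congr (_ + _).
rewrite (reindex_inj rev_ord_inj) /=.
rewrite (eq_bigl (fun k : 'I_n.+1 => ~~ (uphalf n <= k)%N)); last first.
  move=> k; rewrite /= subSS; have := ltn_ord k.
  by have := odd_double_half n; rewrite uphalf_half; case: (odd n) => /=; lia.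
by apply: eq_bigr => k _; rewrite subSS cw_mass_sym// -ltnS.
Qed.

Lemma upper_mass_ge0 (R : realType) n j : 0 <= upper_mass R n j.
Proof. by apply: sumr_ge0 => i _; exact: cw_mass_ge0. Qed.

Lemma upper_mass_le_total (R : realType) n j : (0 < n)%N ->
  upper_mass R n j <= cw_total R n.
Proof.
move=> n0; rewrite upper_massE// /cw_total [leRHS](bigID (fun k : 'I_n.+1 =>
  (uphalf n + j <= k)%N)) /= lerDl.
by apply: sumr_ge0 => i _; exact: cw_mass_ge0.
Qed.

Lemma upper_mass_eq0 (R : realType) n (q : R) j : 0 < q -> q ^+ 4 = n%:R ->
  q < lattice q n j -> upper_mass R n j = 0.
Proof.
move=> q0 qn qx; rewrite /upper_mass big1// => i _.
apply: cw_mass_site_eq0.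
have : n%:R < site R n j.
  by move: qx; rewrite /lattice ltr_pdivlMr ?exprn_gt0// -exprS qn.
move=> /lt_le_trans; apply; rewrite /site ler_nat; lia.
Qed.

(** The constant of upper_prob_tail. *)
Definition upper_const {R : realType} (K D : R) : R :=
  let C := cmp_const K D in C + 2 * C * (2 * (D + C) + expR (4 * C)).

(** The normalised form of upper_mass_tail. With kap the ratio of the factor
there to the inverse of the total mass, the case z = 0 bounds 1 - kap. If
kap >= 1/2, the upper probability p inherits a Gaussian bound from the tail;
otherwise q is bounded, and p, which is 0 for z > q, is trivially at most
exp(q^2 - z^2). *)
Lemma upper_prob_tail (R : realType) (K D : R) T n (q z : R) j :
  quartic_tail K D T -> (0 < n)%N -> 0 < q -> q ^+ 4 = n%:R ->
  0 <= z -> z <= lattice q n j -> lattice q n j <= z + 2 / q ^+ 3 ->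
  `|upper_mass R n j / cw_total R n - T z| <=
  upper_const K D / q ^+ 2 * expR (- z ^+ 2).
Proof.
move=> qT n0 q0 qn z0 zx xz.
have K0 := tail_K_ge0 qT.
have D0 := quartic_tail_D_ge0 qT.
set C := cmp_const K D.
have C0 : 0 <= C by rewrite /C /cmp_const !addr_ge0 ?mulr_ge0 ?expR_ge0.
have Z0 := cw_total_gt0 R n.
have q1 : 1 <= q.
  have : 1 <= q ^+ 4 by rewrite qn ler1n.
  by rewrite expr_ge1// ltW.
have q20 : 0 < q ^+ 2 by rewrite exprn_gt0.
have h0 : 0 <= 2 / q ^+ 3 by rewrite divr_ge0// exprn_ge0// ltW.
set kap := K * (2 / q ^+ 3) / cw_scale R n * cw_total R n.
set p := upper_mass R n j / cw_total R n.
set E := expR (- z ^+ 2).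
have E0 : 0 <= E by exact: expR_ge0.
have kE i : K * (2 / q ^+ 3) / cw_scale R n * upper_mass R n i =
    kap * (upper_mass R n i / cw_total R n).
  rewrite /kap; field.
  by rewrite !lt0r_neq0// cw_scale_gt0.
have main : `|kap * p - T z| <= C / q ^+ 2 * E.
  by rewrite -kE; exact: upper_mass_tail.
(* Both the spins >= 0 and the spins > 0 are compared with the tail at 0, which
   is 1/2; their masses add up to the total. *)
have kap1 : `|1 - kap| <= 2 * (C / q ^+ 2).
  have norm0 i : 0 <= lattice q n i -> lattice q n i <= 2 / q ^+ 3 ->
      `|kap * (upper_mass R n i / cw_total R n) - 1 / 2| <= C / q ^+ 2.
    move=> x0 xh; rewrite -(tail_half qT) -kE.
    have := @upper_mass_tail R K D T n q 0 i qT n0 q0 qn (lexx 0) x0.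
    by rewrite add0r expr0n oppr0 expR0 mulr1; exact.
  have l0 i : 0 <= lattice q n i.
    by rewrite divr_ge0 ?site_ge0// exprn_ge0// ltW.
  have lh i : (odd n + i.*2 <= 2)%N -> lattice q n i <= 2 / q ^+ 3.
    by move=> i2; rewrite ler_pM2r ?invr_gt0 ?exprn_gt0// /site ler_nat.
  have h1 := norm0 0%N (l0 _) (lh 0%N ltac:(by case: (odd n))).
  have h2 := norm0 (~~ odd n) (l0 _)
    (lh (~~ odd n : nat) ltac:(by case: (odd n))).
  have tot := upper_mass_total R n0.
  have -> : 1 - kap = (1 / 2 - kap * (upper_mass R n 0 / cw_total R n)) +
      (1 / 2 - kap * (upper_mass R n (~~ odd n) / cw_total R n)).
    rewrite {1}(_ : kap = kap *
        ((upper_mass R n 0 + upper_mass R n (~~ odd n)) / cw_total R n)).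
      by field; rewrite lt0r_neq0.
    by rewrite tot divff ?mulr1// lt0r_neq0.
  rewrite (le_trans (ler_normD _ _))// distrC [X in _ + X]distrC; lra.
have p0 : 0 <= p by rewrite divr_ge0 ?upper_mass_ge0// ltW.
have p1 : p <= 1 by rewrite ler_pdivrMr// mul1r upper_mass_le_total.
have Cq : C / q ^+ 2 <= C by rewrite ler_pdivrMr// ler_peMr// exprn_ege1.
have Cq0 : 0 <= C / q ^+ 2 by rewrite divr_ge0// ltW.
have pE :
  `|1 - kap| * p <= 2 * (C / q ^+ 2) * ((2 * (D + C) + expR (4 * C)) * E).
  have [k2|k2] := leP (1 / 2) kap.
    apply: ler_pM => //.
    have Tz : T z <= D * E.
      apply: le_trans (tail_gauss qT z0) _; rewrite ler_wpM2l// ler_expR lerN2.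
      by have := sqr_ge0 z; lra.
    have CE : C / q ^+ 2 * E <= C * E by rewrite ler_wpM2r.
    have kp : kap * p <= (D + C) * E.
      by move: main; rewrite ler_norml (mulrDl D C) => /andP[_]; lra.
    have kp2 : 1 / 2 * p <= kap * p by rewrite ler_wpM2r.
    have eE : 0 <= expR (4 * C) * E by rewrite mulr_ge0// expR_ge0.
    rewrite (mulrDl _ (expR _)) -(mulrA 2); lra.
  apply: ler_pM => //.
  have qC : q ^+ 2 <= 4 * C.
    have : 1 / 2 <= 2 * (C / q ^+ 2).
      by apply: le_trans kap1; rewrite ger0_norm; lra.
    rewrite mulrA ler_pdivlMr//; lra.
  have [zq|qz] := leP z q.
    apply: le_trans p1 _.
    apply: (@le_trans _ _ (expR (4 * C) * E)).
      rewrite -expRD -[leLHS]expR0 ler_expR subr_ge0; apply: le_trans qC.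
      by rewrite lerXn2r ?nnegrE// ltW.
    by rewrite ler_wpM2r// lerDr mulr_ge0// addr_ge0.
  rewrite /p (upper_mass_eq0 q0 qn (lt_le_trans qz zx)) mul0r.
  by rewrite mulr_ge0// addr_ge0 ?expR_ge0// mulr_ge0// addr_ge0.
have -> : p - T z = (1 - kap) * p + (kap * p - T z) by ring.
rewrite (le_trans (ler_normD _ _))// normrM (ger0_norm p0).
apply: le_trans (lerD pE main) _.
rewrite /upper_const -/C le_eqVlt; apply/orP; left; apply/eqP; ring.
Qed.

(** * The quartic density *)

Lemma quartic_K_ge0 (R : realType) : 0 <= quartic_K R.
Proof.
by rewrite /quartic_K invr_ge0; apply: Rintegral_ge0 => x _; exact: expR_ge0.
Qed.

Lemma quartic_density_ge0 (R : realType) (x : R) : 0 <= quartic_density x.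
Proof. by rewrite mulr_ge0 ?expR_ge0 ?quartic_K_ge0. Qed.

Lemma continuous_quartic_density (R : realType) :
  continuous (@quartic_density R).
Proof.
move=> x; rewrite /quartic_density; apply: cvgM; first exact: cvg_cst.
apply: (@continuous_comp _ _ _ (fun x : R => - x ^+ 4 / 12) expR).
  apply: cvgM; last exact: cvg_cst.
  by apply: cvgN; exact: exprn_continuous.
exact: continuous_expR.
Qed.

Lemma measurable_quartic_density (R : realType) (D : set R) :
  measurable_fun D (fun x : R => (quartic_density x)%:E).
Proof.
apply/measurable_EFinP; apply: measurable_funTS.
by apply: continuous_measurable_fun; exact: continuous_quartic_density.
Qed.

(** The measure with density quartic_density. *)
Definition quartic_mass (R : realType) (A : set R) : \bar R :=
  (\int[lebesgue_measure]_(x in A) (quartic_density x)%:E)%E.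

(** Its upper tail, as a real number. *)
Definition quartic_upper (R : realType) (a : R) : R :=
  fine (quartic_mass `]a, +oo[%classic).

Lemma quartic_mass_ge0 (R : realType) (A : set R) : (0 <= quartic_mass A)%E.
Proof.
by apply: integral_ge0 => x _; rewrite lee_fin; exact: quartic_density_ge0.
Qed.

Lemma quartic_massU (R : realType) (A B : set R) :
  measurable A -> measurable B -> [disjoint A & B] ->
  quartic_mass (A `|` B) = (quartic_mass A + quartic_mass B)%E.
Proof.
move=> mA mB AB; apply: ge0_integral_setU => //.
  exact: measurable_quartic_density.
by move=> x _; rewrite lee_fin; exact: quartic_density_ge0.
Qed.

Section Normalised.
Context {R : realType}.
Hypothesis mass1 : quartic_mass [set: R] = 1%E.

Lemma quartic_mass_fin (A : set R) :
  measurable A -> quartic_mass A \is a fin_num.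
Proof.
move=> mA; rewrite ge0_fin_numE ?quartic_mass_ge0//.
apply: (@le_lt_trans _ _ 1%E); last by rewrite ltry.
rewrite -mass1; apply: ge0_subset_integral => //.
  exact: measurable_quartic_density.
by move=> x _; rewrite lee_fin; exact: quartic_density_ge0.
Qed.

Lemma quartic_upper_itv (a b : R) : a <= b ->
  quartic_upper a - quartic_upper b = fine (quartic_mass `]a, b]%classic).
Proof.
move=> ab; rewrite /quartic_upper.
have -> : `]a, +oo[%classic = `]a, b]%classic `|` `]b, +oo[%classic.
  by rewrite -itv_bndbnd_setU.
rewrite quartic_massU//; last first.
  apply/disj_setPS => x [] /=; rewrite !in_itv/= !andbT => /andP[_ xb] bx.
  by move: xb; rewrite leNgt bx.
by rewrite fineD ?quartic_mass_fin// addrK.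
Qed.

Lemma quartic_mass_itv_bounds (a b : R) : 0 <= a -> a <= b ->
  quartic_K R * (b - a) * expR (- b ^+ 4 / 12) <=
    fine (quartic_mass `]a, b]%classic) <=
  quartic_K R * (b - a) * expR (- a ^+ 4 / 12).
Proof.
move=> a0 ab.
have cstE (c : R) :
  (\int[lebesgue_measure]_(x in `]a, b]%classic) c%:E)%E = (c * (b - a))%:E.
  rewrite integral_cst//= lebesgue_measure_itv/= lte_fin.
  have [ltab|] := ltP a b; first by rewrite -EFinB -EFinM.
  by move=> ba; rewrite (le_anti (_ : a <= b <= a)) ?ab// subrr mulr0 mule0.
have fm := fineK (quartic_mass_fin (measurable_itv `]a, b])).
have E4 x y : 0 <= x -> x <= y ->
    quartic_K R * expR (- y ^+ 4 / 12) <= quartic_K R * expR (- x ^+ 4 / 12).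
  move=> x0 xy; rewrite ler_wpM2l ?quartic_K_ge0// ler_expR ler_pM2r//.
  by rewrite lerN2 lerXn2r ?nnegrE//; lra.
rewrite mulrAC [X in _ <= _ <= X]mulrAC; apply/andP; split.
  rewrite -lee_fin fm -cstE; apply: ge0_le_integral => //=.
  - by move=> x _; rewrite lee_fin mulr_ge0 ?quartic_K_ge0 ?expR_ge0.
  - exact: measurable_quartic_density.
  - move=> x; rewrite in_itv/= => /andP[ax xb]; rewrite lee_fin.
    by apply: E4 => //; lra.
rewrite -lee_fin fm -cstE; apply: ge0_le_integral => //=.
- by move=> x _; rewrite lee_fin quartic_density_ge0.
- exact: measurable_quartic_density.
- move=> x; rewrite in_itv/= => /andP[ax xb]; rewrite lee_fin.
  by apply: E4 => //; lra.
Qed.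

(** The symmetry of the density. *)
Lemma quartic_mass_lower (a : R) :
  fine (quartic_mass `]-oo, (- a)]%classic) = quartic_upper a.
Proof.
rewrite /quartic_upper /quartic_mass ge0_integration_by_substitutionNy.
- rewrite integral_itv_obnd_cbnd; last exact: measurable_quartic_density.
  congr fine; apply: eq_integral => x _ /=.
  by rewrite /quartic_density (_ : (- x) ^+ 4 = x ^+ 4)//; ring.
- by apply: continuous_subspaceT; exact: continuous_quartic_density.
- by move=> x _; exact: quartic_density_ge0.
Qed.

Lemma quartic_mass_le (a : R) :
  fine (quartic_mass `]-oo, a]%classic) = 1 - quartic_upper a.
Proof.
rewrite /quartic_upper.
have : fine (quartic_mass [set: R]) = 1 by rewrite mass1.
have -> : [set: R] = `]-oo, a]%classic `|` `]a, +oo[%classic.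
  by rewrite -itv_bndbnd_setU// set_itvNyy.
rewrite quartic_massU//; last first.
  apply/disj_setPS => x [] /=; rewrite !in_itv/= !andbT => xa ax.
  by move: xa; rewrite leNgt ax.
by rewrite fineD ?quartic_mass_fin// => <-; rewrite addrK.
Qed.

Lemma quartic_upper0 : quartic_upper (0 : R) = 1 / 2.
Proof.
have := quartic_mass_lower 0; rewrite oppr0 quartic_mass_le; lra.
Qed.

(** For x >= a, exp(- x^4 / 12) is at most e^27 exp(- 3 x^2), hence at most
e^27 exp(- 2 a^2) exp(- x^2), and the Gaussian integral is known. *)
Lemma quartic_upper_gauss (a : R) : 0 <= a -> quartic_upper a <=
  quartic_K R * expR 27 * Num.sqrt pi * expR (- (2 * a ^+ 2)).
Proof.
move=> a0; rewrite /quartic_upper -lee_fin fineK ?quartic_mass_fin//.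
set c := quartic_K R * expR 27 * expR (- (2 * a ^+ 2)).
have c0 : 0 <= c by rewrite !mulr_ge0 ?quartic_K_ge0 ?expR_ge0.
have -> : quartic_K R * expR 27 * Num.sqrt pi * expR (- (2 * a ^+ 2)) =
  c * Num.sqrt pi by rewrite /c; ring.
have mg D : measurable_fun D (EFin \o @gauss_fun R).
  by apply/measurable_EFinP/measurable_funTS; exact: measurable_gauss_fun.
rewrite EFinM -integralT_gauss.
apply: (@le_trans _ _ (\int[lebesgue_measure]_(x in `]a, +oo[%classic)
    (c%:E * (gauss_fun x)%:E))%E).
  apply: ge0_le_integral => //=.
  - by move=> x _; rewrite lee_fin quartic_density_ge0.
  - exact: measurable_quartic_density.
  - exact: (measurable_funeM c%:E (mg _)).
  - move=> x; rewrite in_itv/= andbT => ax; rewrite -EFinM lee_fin.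
    rewrite /quartic_density /c /gauss_fun -!mulrA ler_wpM2l ?quartic_K_ge0//.
    apply: le_trans (expR_quartic_le 3 x) _.
    rewrite (_ : 3 * 3 ^+ 2 = 27); last by ring.
    rewrite ler_wpM2l ?expR_ge0// -expRD ler_expR.
    have : a ^+ 2 <= x ^+ 2 by rewrite lerXn2r ?nnegrE//; lra.
    lra.
rewrite ge0_integralZl_EFin//=; last first.
- exact: mg.
- by move=> x _; rewrite lee_fin gauss_fun_ge0.
rewrite lee_wpmul2l ?lee_fin//.
apply: ge0_subset_integral => //; first exact: mg.
by move=> x _; rewrite lee_fin gauss_fun_ge0.
Qed.

Lemma quartic_upper_tail : quartic_tail (quartic_K R)
  (quartic_K R * expR 27 * Num.sqrt pi) (@quartic_upper R).
Proof.
split.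
- exact: quartic_K_ge0.
- move=> a b a0 ab; rewrite quartic_upper_itv//.
  by case/andP: (quartic_mass_itv_bounds a0 ab).
- move=> a b a0 ab; rewrite quartic_upper_itv//.
  by case/andP: (quartic_mass_itv_bounds a0 ab).
- by move=> a; apply/fine_ge0/quartic_mass_ge0.
- exact: quartic_upper_gauss.
- exact: quartic_upper0.
Qed.

End Normalised.

(** * The law of the total spin *)

(** The total spin of a configuration. *)
Definition spin_sum (R : realType) (n : nat) (s : {ffun 'I_n -> bool}) : R :=
  \sum_(i < n) spin R (s i).

(** The number of up spins, that is, of spins equal to 1. *)
Definition ups (n : nat) (s : {ffun 'I_n -> bool}) : nat := #|[pred i | s i]|.

Lemma spin_sumE (R : realType) n (s : {ffun 'I_n -> bool}) :
  spin_sum R s = 2 * (ups s)%:R - n%:R.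
Proof.
have spinE b : spin R b = 2 * b%:R - 1 by case: b; rewrite /spin /=; ring.
rewrite /spin_sum (eq_bigr _ (fun i _ => spinE (s i))) sumrB -mulr_sumr.
rewrite sumr_const card_ord -natr_sum; congr (2 * _%:R - _).
rewrite /ups -sum1_card [RHS]big_mkcond; apply: eq_bigr => i _.
by rewrite inE; case: (s i).
Qed.

Lemma spin_pairs (R : realType) n (s : {ffun 'I_n -> bool}) :
  \sum_(i < n) \sum_(j < n | (i < j)%N) spin R (s i) * spin R (s j) =
  (spin_sum R s ^+ 2 - n%:R) / 2.
Proof.
set x := fun i => spin R (s i).
set L := \sum_(i < n) \sum_(j < n | (i < j)%N) x i * x j.
have sq1 i : x i * x i = 1 by rewrite /x; case: (s i); rewrite /spin; ring.
have LE : \sum_(i < n) \sum_(j < n | (j < i)%N) x i * x j = L.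
  rewrite /L (exchange_big_dep xpredT)//=.
  apply: eq_bigr => i _; apply: eq_bigr => j _.
  exact: mulrC.
have -> : spin_sum R s ^+ 2 = L + (n%:R + L).
  rewrite -{2}LE {1}/L expr2 /spin_sum mulr_suml.
  have -> : n%:R = \sum_(i < n) x i * x i :> R.
    by rewrite (eq_bigr _ (fun i _ => sq1 i)) sumr_const card_ord.
  rewrite -!big_split /=; apply: eq_bigr => i _; rewrite mulr_sumr.
  rewrite (bigID (fun j : 'I_n => (i < j)%N)) /=; congr (_ + _).
  rewrite (bigD1 i) ?ltnn//=; congr (_ + _); apply: eq_bigl => j.
  by rewrite -leqNgt ltn_neqAle andbC.
by rewrite -/L; field.
Qed.

Lemma cw_weightE (R : realType) n (s : {ffun 'I_n -> bool}) : (0 < n)%N ->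
  cw_weight R s =
  expR ((2 * (ups s)%:R - n%:R) ^+ 2 / (2 * n%:R)) * expR (- (1 / 2)).
Proof.
move=> n0; rewrite /cw_weight spin_pairs spin_sumE -expRD; congr expR.
by field; rewrite pnatr_eq0 -lt0n.
Qed.

(** Sums over configurations of a function of the number of up spins. *)
Lemma sum_ups (R : realType) n (F : nat -> R) :
  \sum_(s : {ffun 'I_n -> bool}) F (ups s) = \sum_(k < n.+1) 'C(n, k)%:R * F k.
Proof.
pose f (A : {set 'I_n}) : {ffun 'I_n -> bool} := [ffun i => i \in A].
have fbij : bijective f.
  exists (fun s : {ffun 'I_n -> bool} => finset s).
    by move=> A; apply/setP => i; rewrite inE ffunE.
  by move=> s; apply/ffunP => i; rewrite ffunE inE.
rewrite (reindex f) /=; last exact: onW_bij.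
have uf A : ups (f A) = #|A|.
  by rewrite /ups; apply: eq_card => i; rewrite inE ffunE.
rewrite (eq_bigr _ (fun A _ => congr1 F (uf A))).
have cardlt (A : {set 'I_n}) : (#|A| < n.+1)%N.
  by rewrite ltnS -[X in (_ <= X)%N](card_ord n) max_card.
rewrite (partition_big (fun A => Ordinal (cardlt A)) xpredT)//=.
apply: eq_bigr => k _.
rewrite (eq_bigr (fun _ => F k)); last by move=> A /eqP <-.
rewrite sumr_const -[n in 'C(n, _)]card_ord -card_draws mulr_natl.
congr (_ *+ _).
by apply: eq_card => A; rewrite !inE /in_mem /=.
Qed.

Lemma cw_prob_sum (R : realType) n (Q : pred R) : (0 < n)%N ->
  \sum_(s : {ffun 'I_n -> bool} | Q (spin_sum R s)) cw_prob R s =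
  (\sum_(k < n.+1 | Q (2 * k%:R - n%:R)) cw_mass R n k) / cw_total R n.
Proof.
move=> n0; have e0 : expR (- (1 / 2)) != 0 :> R by rewrite gt_eqF ?expR_gt0.
have sumE (P : pred R) :
  \sum_(s : {ffun 'I_n -> bool} | P (spin_sum R s)) cw_weight R s =
    (\sum_(k < n.+1 | P (2 * k%:R - n%:R)) cw_mass R n k) * expR (- (1 / 2)).
  pose F k := if P (2 * k%:R - n%:R) then
    expR ((2 * k%:R - n%:R) ^+ 2 / (2 * n%:R)) * expR (- (1 / 2)) : R else 0.
  rewrite big_mkcond (eq_bigr (fun s => F (ups s))); last first.
    move=> s _; rewrite /F -spin_sumE; case: ifP => // _.
    by rewrite cw_weightE// spin_sumE.
  rewrite sum_ups mulr_suml [RHS]big_mkcond; apply: eq_bigr => k _.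
  by rewrite /F; case: ifP => _; rewrite ?mulr0// /cw_mass mulrA.
rewrite /cw_prob -mulr_suml sumE /cw_Z (sumE xpredT) -/(cw_total R n).
by field; rewrite e0 lt0r_neq0// cw_total_gt0.
Qed.

Section Law.
Context (d : measure_display) (T : measurableType d) (R : realType).
Variables (P : probability T R) (n : nat) (sigma : 'I_n -> {RV P >-> R}).
Hypothesis n_gt0 : (0 < n)%N.
Hypothesis law : critical_curie_weiss sigma.

Let atom (s : {ffun 'I_n -> bool}) : set T :=
  [set t | forall i, sigma i t = spin R (s i)].

Let measurable_atom s : measurable (atom s).
Proof.
have -> : atom s = \bigcap_(i in [set: 'I_n]) sigma i @^-1` [set spin R (s i)].
  by apply/seteqP; split => [t h i _|t h i]; [exact: h|exact: h].
by apply: fin_bigcap_measurable => // i _.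
Qed.

Let spin_inj : injective (spin R).
Proof. by move=> [] [] //=; rewrite /spin => h; exfalso; lra. Qed.

Let total_atom s t : atom s t -> total_spin sigma t = spin_sum R s.
Proof. by move=> h; apply: eq_bigr => i _; exact: h. Qed.

Let atoms_measure (Q : pred {ffun 'I_n -> bool}) :
  P (\bigcup_(s in [set` Q]) atom s) = (\sum_(s | Q s) cw_prob R s)%:E.
Proof.
rewrite measure_fin_bigcup//; last first.
  move=> s s' _ _ [t [hs hs']]; apply/ffunP => i; apply: spin_inj.
  by rewrite -hs -hs'.
rewrite -(@bigfs _ _ _ _ (index_enum {ffun 'I_n -> bool}) Q)//.
- by rewrite -sumEFin; apply: eq_bigr => s _; exact: law.
- exact: index_enum_uniq.
- by move=> s _; rewrite mem_index_enum.
Qed.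

(** The atoms of the law contained in the event and those contained in its
complement bound the two probabilities from below, and these bounds
add up to 1. *)
Lemma total_spin_law (Q : pred R) :
  measurable [set t | Q (total_spin sigma t)] ->
  P [set t | Q (total_spin sigma t)] =
  ((\sum_(k < n.+1 | Q (2 * k%:R - n%:R)) cw_mass R n k) / cw_total R n)%:E.
Proof.
set A := [set t | _] => mA; rewrite -cw_prob_sum//.
set a := \sum_(s | _) _.
have ge (B : set T) (p : pred R) : measurable B ->
    (forall t, p (total_spin sigma t) -> B t) ->
    ((\sum_(s : {ffun 'I_n -> bool} | p (spin_sum R s)) cw_prob R s)%:E
      <= P B)%E.
  move=> mB pB; rewrite -(atoms_measure (fun s => p (spin_sum R s))).
  apply: le_measure; rewrite ?inE//.
    by apply: fin_bigcup_measurable.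
  by move=> t [s ps /total_atom ts]; apply: pB; rewrite ts.
have h1 : (a%:E <= P A)%E by exact: ge.
have h2 := ge (~` A) (fun x => ~~ Q x) (measurableC mA) (fun t => elimN idP).
have tot : \sum_(s : {ffun 'I_n -> bool}) cw_prob R s = 1.
  by rewrite (cw_prob_sum xpredT n_gt0) divff// lt0r_neq0// cw_total_gt0.
have h3 :
  \sum_(s : {ffun 'I_n -> bool} | ~~ Q (spin_sum R s)) cw_prob R s = 1 - a.
  by move: tot; rewrite (bigID (fun s => Q (spin_sum R s))) /= -/a; lra.
move: h1 h2; rewrite h3 probability_setC//.
have PA := fin_num_measure P _ mA; rewrite -(fineK PA) -EFinB !lee_fin => h1 h2.
by congr EFin; lra.
Qed.

End Law.

(** * Comparison of the distribution functions *)

(** The lattice points beyond a threshold z >= 0, strictly or not, are those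
from some index j on, and the first of them is within one step of z. The
predicate Q covers both x > z and x >= z. *)
Lemma upper_threshold (R : realType) n (q z : R) (Q : pred R) :
  (0 < n)%N -> 0 < q -> 0 <= z ->
  (forall x, Q x -> z <= x) -> (forall x, ~~ Q x -> x <= z) ->
  exists j, [/\ z <= lattice q n j, lattice q n j <= z + 2 / q ^+ 3 &
    \sum_(k < n.+1 | Q ((2 * k%:R - n%:R) / q ^+ 3)) cw_mass R n k =
    upper_mass R n j].
Proof.
move=> n0 q0 z0 Qge nQle.
have q30 : 0 < q ^+ 3 by rewrite exprn_gt0.
have Qmono x y : x <= y -> Q x -> Q y.
  rewrite le_eqVlt => /predU1P[<-//|xy Qx]; apply/negPn/negP => /nQle yz.
  by have := Qge _ Qx; lra.
have exQ : exists j, Q (lattice q n j).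
  exists (Num.bound (z * q ^+ 3)); apply/negPn/negP => /nQle.
  apply/negP; rewrite -ltNge /lattice ltr_pdivlMr//.
  apply: (@lt_le_trans _ _ (Num.bound (z * q ^+ 3))%:R).
    by rewrite archi_boundP// mulr_ge0// ltW.
  by rewrite /site ler_nat; lia.
case: (ex_minnP exQ) => j Qj jmin.
exists j; split; first exact: Qge.
- case: j Qj jmin => [|j] _ jmin.
    rewrite -[leLHS]add0r lerD// ler_pM2r ?invr_gt0// /site.
    by rewrite ler_nat; case: (odd n).
  rewrite -addn1 latticeD mulr1 lerD2r; apply: nQle; apply/negP => /jmin.
  by rewrite ltnn.
rewrite upper_massE//; apply: eq_bigl => k.
have [hk|hk] := leqP (uphalf n) k.
  have -> : (2 * k%:R - n%:R) / q ^+ 3 = lattice q n (k - uphalf n).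
    by rewrite /lattice siteE subnKC.
  rewrite -leq_subRL//; apply/idP/idP => [/jmin//|jk].
  apply: Qmono Qj; rewrite -(subnKC jk) latticeD lerDl.
  by rewrite mulr_ge0// divr_ge0// ltW.
have -> : (uphalf n + j <= k)%N = false.
  by apply/negbTE; rewrite -ltnNge (leq_trans hk)// leq_addr.
apply/negbTE/negP => /Qge; apply/negP; rewrite -ltNge.
apply: lt_le_trans z0; rewrite pmulr_llt0 ?invr_gt0// subr_lt0 -natrM ltr_nat.
by have := odd_double_half n; rewrite uphalf_half in hk; lia.
Qed.

(** The distribution function of the rescaled total spin. *)
Definition cw_cdf (R : realType) (n : nat) (q z : R) : R :=
  (\sum_(k < n.+1 | (2 * k%:R - n%:R) / q ^+ 3 <= z) cw_mass R n k)
  / cw_total R n.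

Lemma cw_cdf_upperE (R : realType) n (q z : R) :
  cw_cdf n q z = 1 -
  (\sum_(k < n.+1 | z < (2 * k%:R - n%:R) / q ^+ 3) cw_mass R n k)
  / cw_total R n.
Proof.
have Z0 := cw_total_gt0 R n.
rewrite /cw_cdf; apply/eqP; rewrite eq_sym subr_eq; apply/eqP.
rewrite -mulrDl -[X in X / _](_ : cw_total R n = _) ?divff ?lt0r_neq0//.
rewrite /cw_total.
rewrite (bigID (fun k : 'I_n.+1 => (2 * k%:R - n%:R) / q ^+ 3 <= z)) /=.
by congr (_ + _); apply: eq_bigl => k; rewrite ltNge.
Qed.

Lemma cw_cdf_sym (R : realType) n (q z : R) :
  cw_cdf n q z =
  (\sum_(k < n.+1 | - z <= (2 * k%:R - n%:R) / q ^+ 3) cw_mass R n k)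
  / cw_total R n.
Proof.
rewrite /cw_cdf; congr (_ / _); rewrite (reindex_inj rev_ord_inj) /=.
apply: eq_big => k; last by rewrite subSS cw_mass_sym// -ltnS.
rewrite subSS natrB; last by rewrite -ltnS.
have -> : (2 * (n%:R - k%:R) - n%:R) / q ^+ 3 =
  - ((2 * k%:R - n%:R) / q ^+ 3) :> R by ring.
by rewrite lerNl.
Qed.

Lemma quartic_cdf_cmp (R : realType) (K D : R) T n (q z : R) :
  quartic_tail K D T -> (0 < n)%N -> 0 < q -> q ^+ 4 = n%:R ->
  `|cw_cdf n q z - (if 0 <= z then 1 - T z else T (- z))| <=
  upper_const K D / q ^+ 2 * expR (- z ^+ 2).
Proof.
move=> qT n0 q0 qn; case: ifP => [z0|/negbT]; last rewrite -ltNge => z0.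
  rewrite cw_cdf_upperE.
  have [|x|j [zx xz ->]] := @upper_threshold R n q z (> z) n0 q0 z0.
  - by move=> x /ltW.
  - by rewrite -leNgt.
  have -> (u v : R) : 1 - u - (1 - v) = - (u - v) by ring.
  by rewrite normrN; exact: upper_prob_tail.
rewrite cw_cdf_sym.
have Nz0 : 0 <= - z by lra.
have [//|x|j [zx xz ->]] := @upper_threshold R n q (- z) (>= (- z)) n0 q0 Nz0.
- by rewrite /= -ltNge => /ltW.
by rewrite -[z in X in _ <= X]opprK sqrrN; exact: upper_prob_tail.
Qed.

(** With y = 1 + |z|, z^2 >= y^2 / 2 - 1, and taking logarithms the claim
reduces to log(y^2 / p) <= y^2 / p. *)
Lemma powR_gauss_le (R : realType) (p z : R) : 0 < p ->
  (1 + `|z|) `^ p * expR (- z ^+ 2) <= expR 1 * p `^ (p / 2).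
Proof.
move=> p0; set y := 1 + `|z|.
have y0 : 0 < y by rewrite /y ltr_pwDl.
have yz : - z ^+ 2 <= 1 - y ^+ 2 / 2.
  have := sqr_ge0 (1 - `|z|); rewrite -[z ^+ 2]real_normK ?num_real// /y.
  set w := `|z|; rewrite !expr2; lra.
rewrite /powR !gt_eqF// -!expRD ler_expR.
have y2 : 0 < y ^+ 2 by rewrite exprn_gt0.
have : ln (y ^+ 2 / p) <= y ^+ 2 / p.
  by apply: ltW; apply: ln_sublinear; rewrite divr_gt0.
rewrite ln_div ?posrE// lnXn// mulr2n => h.
have : p * (ln y + ln y - ln p) <= y ^+ 2.
  by rewrite mulrC -ler_pdivlMr.
lra.
Qed.

(** * Random variables *)

Lemma measurable_total_spin d (T : measurableType d) (R : realType)
    (P : probability T R) n (sigma : 'I_n -> {RV P >-> R}) :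
  measurable_fun setT (total_spin sigma).
Proof. by apply: measurable_sum => i; exact: measurable_funP. Qed.

Lemma critical_cw_cdf d (T : measurableType d) (R : realType)
    (P : probability T R) n (sigma : 'I_n -> {RV P >-> R}) (q z : R) :
  (0 < n)%N -> critical_curie_weiss sigma ->
  P [set t | total_spin sigma t / q ^+ 3 <= z] = (cw_cdf n q z)%:E.
Proof.
move=> n0 law.
rewrite (total_spin_law n0 law (Q := fun x => x / q ^+ 3 <= z))//.
have mf : measurable_fun setT (fun t => total_spin sigma t / q ^+ 3).
  by apply: measurable_funM => //; exact: measurable_total_spin.
have := mf measurableT _ (measurable_itv `]-oo, z]); rewrite setTI.
by congr measurable; apply/seteqP; split => t /=; rewrite in_itv.
Qed.

Lemma density_mass1 d (T : measurableType d) (R : realType)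
    (P : probability T R) (Y : {RV P >-> R}) :
  has_density Y (@quartic_density R) -> quartic_mass [set: R] = 1%E.
Proof.
move=> /(_ setT measurableT) dY; rewrite /quartic_mass -dY.
by rewrite /distribution /pushforward preimage_setT probability_setT.
Qed.

Lemma density_cdf d (T : measurableType d) (R : realType)
    (P : probability T R) (Y : {RV P >-> R}) (z : R) :
  has_density Y (@quartic_density R) ->
  P [set t | Y t <= z] =
  (if 0 <= z then 1 - quartic_upper z else quartic_upper (- z))%:E.
Proof.
move=> dY; have m1 := density_mass1 dY.
have -> : [set t | Y t <= z] = Y @^-1` `]-oo, z]%classic.
  by apply/seteqP; split => t /=; rewrite in_itv.
have -> : P (Y @^-1` `]-oo, z]%classic) = quartic_mass `]-oo, z]%classic.
  exact: dY.
rewrite -(fineK (quartic_mass_fin m1 (measurable_itv `]-oo, z]))).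
case: ifP => z0; congr EFin; first exact: quartic_mass_le.
by rewrite -quartic_mass_lower opprK.
Qed.

Unset Implicit Arguments.

Theorem theorem4p1 (R : realType) :
  exists B : R, 0 < B /\
    forall (n : nat), (1 <= n)%N ->
    forall (d : measure_display) (T : measurableType d) (P : probability T R)
           (sigma : 'I_n -> {RV P >-> R}),
      critical_curie_weiss sigma ->
    forall (d' : measure_display) (T' : measurableType d')
           (P' : probability T' R) (Y : {RV P' >-> R}),
      has_density Y (@quartic_density R) ->
    let W : T -> R := fun t => total_spin sigma t / n%:R `^ (3 / 4) in
    forall p z : R, 3 <= p ->
      (`| P [set t | (W t <= z)%R] - P' [set t | (Y t <= z)%R] |
        <= (B `^ p * p `^ (p / 2) /
            ((1 + `|z|) `^ p * n%:R `^ (1 / 2)))%:E)%E.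
Proof.
set K := quartic_K R; set D := K * expR 27 * Num.sqrt pi.
set C := upper_const K D.
have K0 : 0 <= K := quartic_K_ge0 R.
have D0 : 0 <= D by rewrite !mulr_ge0 ?expR_ge0 ?sqrtr_ge0.
have C0 : 0 <= C.
  by rewrite /C /upper_const /cmp_const !(addr_ge0, mulr_ge0) ?expR_ge0.
have B0 : 0 <= C * expR 1 by rewrite mulr_ge0 ?expR_ge0.
exists (1 + C * expR 1); split; first by rewrite ltr_pwDl.
move=> n n0 d T P sigma law d' T' P' Y dY W p z p3.
have nR0 : 0 < n%:R :> R by rewrite ltr0n.
set q : R := n%:R `^ (1 / 4).
have q0 : 0 < q by rewrite powR_gt0.
have qpow k : n%:R `^ (k%:R / 4) = q ^+ k.
  by rewrite -powR_mulrn ?ltW// /q -powRrM; congr (_ `^ _); field.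
have qn : q ^+ 4 = n%:R by rewrite -qpow divff// powRr1// ltW.
have q3 : n%:R `^ (3 / 4) = q ^+ 3 by rewrite -qpow.
have q2 : n%:R `^ (1 / 2) = q ^+ 2.
  by rewrite -qpow; congr (_ `^ _); field.
rewrite /W q3 q2 critical_cw_cdf// (density_cdf _ dY) -EFinB abse_EFin lee_fin.
have tail := quartic_upper_tail (density_mass1 dY).
apply: le_trans (quartic_cdf_cmp z tail n0 q0 qn) _.
have y0 : 0 < (1 + `|z|) `^ p by rewrite powR_gt0// ltr_pwDl.
have q20 : 0 < q ^+ 2 by rewrite exprn_gt0.
rewrite ler_pdivlMr ?mulr_gt0//.
have -> : upper_const K D / q ^+ 2 * expR (- z ^+ 2) *
    ((1 + `|z|) `^ p * q ^+ 2) = C * ((1 + `|z|) `^ p * expR (- z ^+ 2)).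
  by rewrite /C; field; rewrite lt0r_neq0.
apply: (@le_trans _ _ (C * expR 1 * p `^ (p / 2))).
  by rewrite -mulrA ler_wpM2l// powR_gauss_le//; lra.
rewrite ler_wpM2r ?powR_ge0//.
apply: (@le_trans _ _ (1 + C * expR 1)); first by rewrite lerDr.
by apply: le1r_powR; lra.
Qed.
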